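(* Let $X$ be a Banach space isomorphic to a Hilbert space and let $A$ be the generator of a uniformly exponentially stable $C_0$-semigroup $\mathbf T=\{T(t)\}_{t\ge0}$ on $X$. Then the following are equivalent: (1) $\mathbf T$ is left-invertible; (2) every element of $L_A$ is strongly positive.
   Context: $X^{*}$ denotes the space of all bounded antilinear functionals on $X$, and $\langle f,x\rangle$ the duality pairing of $f\in X^{*}$ with $x\in X$. $B(X,X^{*})$ is the space of bounded linear operators $X\to X^{*}$. $Q\in B(X,X^{*})$ is positive if $\langle Qx,x\rangle\ge0$ for all $x$, and strongly positive if there is $\theta>0$ with $\langle Qx,x\rangle\ge\theta\|x\|^{2}$ for all $x\in X$; $B^{+}(X,X^{*})$ is the set of positive operators. $L_A$ is the set of all $Q\in B^{+}(X,X^{*})$ with $\langle QAx,x\rangle+\langle Qx,Ax\rangle\le -\|x\|^{2}$ for all $x\in D(A)$. The semigroup $\mathbf T$ is left-invertible if there is a function $t\mapsto m(t)>0$ such that $\|T(t)x\|\ge m(t)\|x\|$ for all $x\in X$ and all $t\ge0$. Uniform exponential stability means $\|T(t)\|\le Me^{-\varepsilon t}$ for some $M\ge1,\varepsilon>0$ and all $t\ge0$. *)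

(* Defs.v *)
(* Complex scalars: Cx R := R[i] (mathcomp-real-closed
   complex numbers over a realType R), with its numClosedField norm/order. *)
From mathcomp Require Import all_boot all_algebra.
From mathcomp Require Import all_classical all_reals all_analysis.
From mathcomp Require Import complex.
Import GRing.Theory Num.Theory.
Import numFieldNormedType.Exports numFieldTopology.Exports.
Set Implicit Arguments. Unset Strict Implicit. Unset Printing Implicit Defensive.
Local Open Scope ring_scope.
Local Open Scope classical_set_scope.
Local Open Scope complex_scope.

(* the complex field over R, as a numClosedFieldType (so that the generic
   normed-module instances of MathComp-Analysis apply to it) *)
Definition Cx (R : realType) : numClosedFieldType := R[i].

Section Defs.
Variable R : realType.
Local Notation C := (Cx R).

(* H is a Hilbert space: a complete normed space whose norm comes from an
   inner product ip (linear in the 1st slot, conjugate symmetric). *)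
Definition inner_product_for (H : normedModType C) (ip : H -> H -> C) :=
  (forall (a : C) (x y z : H), ip (a *: x + y) z = a * ip x z + ip y z) /\
  (forall x y : H, ip y x = (ip x y)^*) /\
  (forall x : H, ip x x = `|x| ^+ 2).

(* topological linear isomorphism between normed spaces *)
Definition lin_isomorphism (X Y : normedModType C) (J : X -> Y) :=
  (forall (a : C) (x y : X), J (a *: x + y) = a *: J x + J y) /\
  continuous J /\
  exists Jinv : Y -> X, cancel J Jinv /\ cancel Jinv J /\ continuous Jinv.

(* X is isomorphic to a Hilbert space *)
Definition isomorphic_to_Hilbert (X : normedModType C) :=
  exists (H : completeNormedModType C) (ip : H -> H -> C) (J : X -> H),
    inner_product_for ip /\ lin_isomorphism J.

Variable X : completeNormedModType C.

(* bounded linear operator X -> X *)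
Definition bounded_linear (S : X -> X) :=
  (forall (a : C) (x y : X), S (a *: x + y) = a *: S x + S y) /\ continuous S.

(* C_0-semigroup {T(t)}_{t>=0} *)
Definition C0_semigroup (T : R -> X -> X) :=
  (forall t, 0 <= t -> bounded_linear (T t)) /\
  (forall x, T 0 x = x) /\
  (forall t s x, 0 <= t -> 0 <= s -> T (t + s) x = T t (T s x)) /\
  (forall x, T t x @[t --> 0^'+] --> x).

(* (A, D(A)) is the generator of T *)
Definition generator (T : R -> X -> X) (D : set X) (A : X -> X) :=
  forall x,
    (D x <-> exists l : X, (h^-1)%:C *: (T h x - x) @[h --> 0^'+] --> l) /\
    (D x -> (h^-1)%:C *: (T h x - x) @[h --> 0^'+] --> A x).

Definition unif_exp_stable (T : R -> X -> X) :=
  exists M eps : R, 1 <= M /\ 0 < eps /\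
    forall t x, 0 <= t -> `|T t x| <= (M * expR (- (eps * t)))%:C * `|x|.

Definition left_invertible (T : R -> X -> X) :=
  exists m : R -> R, (forall t, 0 <= t -> 0 < m t) /\
    forall t x, 0 <= t -> (m t)%:C * `|x| <= `|T t x|.

(* f is a bounded antilinear functional, i.e. f in the antidual of X *)
Definition bounded_antilinear (f : X -> C) :=
  (forall (a : C) (x y : X), f (a *: x + y) = a^* * f x + f y) /\ continuous f.

(* Q \in B(X, dual X); the pairing <Q x, y> is Q x y *)
Definition bounded_op_to_dual (Q : X -> X -> C) :=
  (forall x, bounded_antilinear (Q x)) /\
  (forall (a : C) (x y z : X), Q (a *: x + y) z = a * Q x z + Q y z) /\
  (exists M : R, forall x y, `|Q x y| <= M%:C * `|x| * `|y|).

Definition positive_op (Q : X -> X -> C) := forall x, 0 <= Q x x.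

Definition strongly_positive (Q : X -> X -> C) :=
  exists theta : R, 0 < theta /\ forall x, theta%:C * `|x| ^+ 2 <= Q x x.

(* Q \in L_A *)
Definition in_LA (D : set X) (A : X -> X) (Q : X -> X -> C) :=
  bounded_op_to_dual Q /\ positive_op Q /\
  forall x, D x -> Q (A x) x + Q x (A x) <= - `|x| ^+ 2.

End Defs.

(* Main.v *)
Require Import Defs.
From mathcomp Require Import all_boot all_order all_algebra.
From mathcomp Require Import all_classical all_reals all_analysis.
From mathcomp Require Import complex ring lra.
Import numFieldNormedType.Exports numFieldTopology.Exports.
Import Order.TTheory GRing.Theory Num.Theory.
Set Implicit Arguments. Unset Strict Implicit. Unset Printing Implicit Defensive.
Local Open Scope ring_scope.
Local Open Scope classical_set_scope.
Local Open Scope complex_scope.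

(** No integral is formed anywhere. The orbit means behind the density of the domain are limits of
    dyadic averages, and the Gramian is a limit of Riemann sums along an ultrafilter. Likewise no
    orbit is differentiated inside a form: a second-order expansion over one time step replaces the
    derivative, with an error uniform in time, so that the errors of all steps add up to a small
    total. The estimates are made for real bilinear forms, because the order on [Cx R] is partial. A
    real form that is symmetric and invariant under multiplication by i is turned back into a
    sesquilinear one at the end. The finite horizon [tau] leaves a boundary term
    [b (T tau x) (T tau x) - b x x] in the Lyapunov identity. The Hilbert structure gives
    [b x x >= a |x|^2], and stability makes the other term at most half of that. *)

(** (1) => (2): for [x] in [D(A)], summing the increments of [<Q T(t)x, T(t)x>]
    over a fine subdivision of [0, 1] and using the Lyapunov inequality at each
    node gives [<Qx, x> >= c^2 |x|^2], because left-invertibility at time 1 keeps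
    [|T(t)x| >= c |x|] on [0, 1]; the bound extends to [X] by density of [D(A)].

    (2) => (1): let [b] be the Hilbert form carried to [X]. For [tau] large,
    exponential stability makes [Q := c int_0^tau b(T(t)x, T(t)y) dt] an element
    of [L_A], so [Q] is strongly positive. Since
    [int_0^tau b(T(t)x, T(t)x) dt <= C s |x|^2 + C' |T(s)x|^2], a small [s] yields
    [|T(s)x| >= m |x|], and the semigroup law propagates this to all times. *)

(** * Real-valued norms *)

Section RealNorm.
Variables (R : realType) (V : normedModType (Cx R)).
Implicit Types x y : V.

(** The norm lives in [Cx R], whose order is partial; its real part gives access to a total order
    and to [lra]. *)
Definition rnorm (x : V) : R := complex.Re `|x|.

Lemma normE x : `|x| = (rnorm x)%:C.
Proof. by rewrite /rnorm RRe_real. Qed.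

Lemma rnorm_ge0 x : 0 <= rnorm x.
Proof. by rewrite -ler0c -normE. Qed.

Lemma rnormD x y : rnorm (x + y) <= rnorm x + rnorm y.
Proof. by rewrite -lecR rmorphD /= -!normE ler_normD. Qed.

Lemma rnormN x : rnorm (- x) = rnorm x.
Proof. by rewrite /rnorm normrN. Qed.

Lemma rdistC x y : rnorm (x - y) = rnorm (y - x).
Proof. by rewrite /rnorm distrC. Qed.

Lemma rnormZ (a : R) x : rnorm (a%:C *: x) = `|a| * rnorm x.
Proof.
apply: (@complexI R); rewrite rmorphM /= -!normE normrZ; congr (_ * _).
by rewrite normc_def /= expr0n addr0 sqrtr_sqr.
Qed.

Lemma rnorm0 : rnorm 0 = 0.
Proof. by rewrite /rnorm normr0. Qed.

Lemma rnorm_eq0 x : rnorm x = 0 -> x = 0.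
Proof. by move=> h; apply/eqP; rewrite -normr_eq0 normE h. Qed.

Lemma rcvgP T (F : set_system T) {FF : Filter F} (f : T -> V) (l : V) :
  f @ F --> l <-> forall e : R, 0 < e -> \forall t \near F, rnorm (l - f t) < e.
Proof.
split=> [/cvgrPdist_lt fl e e0 | fl].
  have := fl e%:C; rewrite ltcR => /(_ e0); apply: filterS => t.
  by rewrite normE ltcR.
apply/cvgrPdist_lt => e e0.
have er : e = (complex.Re e)%:C by rewrite RRe_real // gtr0_real.
have := fl (complex.Re e); rewrite -ltcR -er => /(_ e0); apply: filterS => t.
by rewrite normE er ltcR.
Qed.

Lemma rcvg_rightP (f : R -> V) (l : V) :
  f t @[t --> 0^'+] --> l <-> forall e : R, 0 < e ->
    exists2 d : R, 0 < d & forall t, 0 < t -> t < d -> rnorm (f t - l) < e.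
Proof.
split=> [/rcvgP fl e /fl|fl].
  case/nbhs_ballP => d /= d0 dP; exists d => // t t0 td.
  by rewrite rdistC; apply: dP; rewrite // -ball_normE /= sub0r normrN gtr0_norm.
apply/rcvgP => e /fl[d d0 dP]; near=> t.
by rewrite rdistC; apply: dP; near: t; [exact: nbhs_right_gt|exact: nbhs_right_lt].
Unshelve. all: by end_near. Qed.

End RealNorm.


(** * Regrouping and shifting finite sums *)

Lemma big_nat_mul (V : nmodType) (F : nat -> V) (n m : nat) :
  \sum_(0 <= k < n * m) F k = \sum_(0 <= i < n) \sum_(0 <= j < m) F (i * m + j)%N.
Proof.
elim: n => [|n IH]; first by rewrite mul0n !big_geq.
rewrite big_nat_recr //= -IH mulSn addnC (@big_cat_nat _ _ _ (n * m)%N) ?leq_addr //=.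
congr (_ + _); rewrite -{1}(add0n (n * m)%N) big_addn addKn.
by apply: eq_bigr => j _; rewrite addnC.
Qed.

(** Both sides are the sum of the first [n + j] terms minus the sums of the first [n] and of the
    first [j], which is symmetric in [n] and [j]. *)
Lemma big_nat_shift (V : zmodType) (F : nat -> V) (n j : nat) :
  \sum_(0 <= k < n) (F (j + k)%N - F k) = \sum_(0 <= k < j) (F (n + k)%N - F k).
Proof.
rewrite !sumrB.
have split a b : \sum_(0 <= k < a) F (b + k)%N =
    \sum_(0 <= k < b + a) F k - \sum_(0 <= k < b) F k.
  rewrite [X in _ = X - _](@big_cat_nat _ _ _ b) ?leq_addr //= addrAC subrr add0r.
  rewrite -{2}(add0n b) big_addn addKn.
  by apply: eq_bigr => k _; rewrite addnC.
by rewrite !split addnC addrAC.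
Qed.

(** * Averages of an orbit over a regular grid *)

Section Averages.
Variables (R : realType) (X : completeNormedModType (Cx R)).
Variables (T : R -> X -> X) (M : R).
Hypothesis sgT : C0_semigroup T.
Hypothesis M_ge1 : 1 <= M.
Hypothesis T_le : forall (t : R) x, 0 <= t -> rnorm (T t x) <= M * rnorm x.
Implicit Types (x y : X) (t s d e : R).

Lemma semigroup0 x : T 0 x = x. Proof. by case: sgT => _ []. Qed.

Lemma semigroupD t s x : 0 <= t -> 0 <= s -> T (t + s) x = T t (T s x).
Proof. by case: sgT => _ [_ [h _]]; exact: h. Qed.

Lemma semigroup_lin t a x y : 0 <= t -> T t (a *: x + y) = a *: T t x + T t y.
Proof. by case: sgT => h _ /h[]. Qed.

Lemma semigroup_add t x y : 0 <= t -> T t (x + y) = T t x + T t y.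
Proof. by move=> t0; rewrite -(scale1r x) semigroup_lin // !scale1r. Qed.

Lemma semigroup_vec0 t : 0 <= t -> T t 0 = 0.
Proof.
by move=> t0; apply: (addrI (T t 0)); rewrite -semigroup_add // !addr0.
Qed.

Lemma semigroup_scale t a x : 0 <= t -> T t (a *: x) = a *: T t x.
Proof. by move=> t0; rewrite -[a *: x]addr0 semigroup_lin // semigroup_vec0 // addr0. Qed.

Lemma semigroup_opp t x : 0 <= t -> T t (- x) = - T t x.
Proof. by move=> t0; rewrite -scaleN1r semigroup_scale // scaleN1r. Qed.

Lemma semigroup_sub t x y : 0 <= t -> T t (x - y) = T t x - T t y.
Proof. by move=> t0; rewrite semigroup_add // semigroup_opp. Qed.

Lemma semigroup_sum t n (F : nat -> X) : 0 <= t ->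
  T t (\sum_(0 <= k < n) F k) = \sum_(0 <= k < n) T t (F k).
Proof.
move=> t0; apply: (big_morph (T t)) => [x y|]; first exact: semigroup_add.
exact: semigroup_vec0.
Qed.

Lemma semigroup_near0 x e : 0 < e ->
  exists2 d, 0 < d & forall t, 0 <= t -> t < d -> rnorm (T t x - x) < e.
Proof.
case: sgT => _ [_ [_ /(_ x)/rcvg_rightP h]] e0; have [d d0 dP] := h _ e0.
exists d => // t; rewrite le_eqVlt => /predU1P[<- _|]; last exact: dP.
by rewrite semigroup0 subrr rnorm0.
Qed.

(** A left Riemann sum for the mean of [T t x] over [[0, n d]]. *)
Definition avg (n : nat) (d : R) (x : X) : X :=
  (n%:R^-1)%:C *: \sum_(0 <= k < n) T (k%:R * d) x.

Lemma avgB n d x y : 0 <= d -> avg n d (x - y) = avg n d x - avg n d y.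
Proof.
move=> d0; rewrite /avg -scalerBr -sumrB; congr (_ *: _).
by apply: eq_bigr => k _; rewrite semigroup_sub // mulr_ge0.
Qed.

Lemma semigroup_avg t n d x : 0 <= t -> 0 <= d ->
  T t (avg n d x) = avg n d (T t x).
Proof.
move=> t0 d0; rewrite /avg semigroup_scale // semigroup_sum //; congr (_ *: _).
by apply: eq_bigr => k _; rewrite -!semigroupD ?mulr_ge0 // addrC.
Qed.

Lemma rnorm_sum_le n (F : nat -> X) (c : R) :
  (forall k, (k < n)%N -> rnorm (F k) <= c) ->
  rnorm (\sum_(0 <= k < n) F k) <= n%:R * c.
Proof.
elim: n => [|n IH] h; first by rewrite big_geq // rnorm0 mul0r.
rewrite big_nat_recr //= -natr1 mulrDl mul1r (le_trans (rnormD _ _)) //.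
by rewrite lerD ?h // IH // => k kn; rewrite h // ltnW.
Qed.

Lemma rnorm_avg_le n d x (c : R) : 0 <= c ->
  (forall k, (k < n)%N -> rnorm (T (k%:R * d) x) <= c) -> rnorm (avg n d x) <= c.
Proof.
move=> c0 h; rewrite /avg rnormZ ger0_norm ?invr_ge0 //.
case: n h => [|n] h; first by rewrite invr0 mul0r.
by rewrite ler_pdivrMl // rnorm_sum_le.
Qed.

Lemma rnorm_avg n d x : 0 <= d -> rnorm (avg n d x) <= M * rnorm x.
Proof.
move=> d0; apply: rnorm_avg_le => [|k _]; last by rewrite T_le // mulr_ge0.
by rewrite mulr_ge0 ?rnorm_ge0 // (le_trans ler01).
Qed.

Lemma avg_mul n m d x : 0 <= d ->
  avg (n * m) d x = avg n (m%:R * d) (avg m d x).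
Proof.
move=> d0; rewrite {1}/avg natrM invfM big_nat_mul rmorphM /= -scalerA.
rewrite [RHS]/avg; congr (_ *: _); rewrite scaler_sumr; apply: eq_bigr => i _.
rewrite semigroup_avg ?mulr_ge0 // /avg; congr (_ *: _); apply: eq_bigr => j _.
rewrite -semigroupD ?mulr_ge0 //; congr (T _ x).
by rewrite natrD natrM; ring.
Qed.

Lemma avg_near n d x e : (0 < n)%N ->
  (forall k, (k < n)%N -> rnorm (T (k%:R * d) x - x) <= e) ->
  rnorm (avg n d x - x) <= e.
Proof.
move=> n0 h; have nN : n%:R != 0 :> R by rewrite pnatr_eq0 -lt0n.
have -> : avg n d x - x = (n%:R^-1)%:C *: \sum_(0 <= k < n) (T (k%:R * d) x - x).
  rewrite sumrB scalerBr; congr (_ - _).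
  rewrite sumr_const_nat subn0 -(scaler_nat n x) scalerA -(rmorph_nat (real_complex R)).
  by rewrite -rmorphM mulVf // scale1r.
rewrite rnormZ ger0_norm ?invr_ge0 // ler_pdivrMl ?ltr0n //.
exact: rnorm_sum_le.
Qed.

(** Discrete form of the identity between [T(s) - 1] applied to the integral of [T(t) x] over
    [[0, h]] and the integral of [T(t) (T(h) x - x)] over [[0, s]]: a short shift of a long mean is
    a short mean of a long increment. *)
Lemma avg_shift n j d x : 0 <= d ->
  T (j%:R * d) (avg n d x) - avg n d x =
  (j%:R / n%:R)%:C *: avg j d (T (n%:R * d) x - x).
Proof.
move=> d0; case: j => [|j].
  by rewrite !mul0r semigroup0 subrr scale0r.
rewrite semigroup_avg ?mulr_ge0 // -avgB // {2}/avg scalerA -rmorphM /=.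
rewrite mulrAC divff ?pnatr_eq0 // mul1r /avg; congr (_ *: _).
transitivity (\sum_(0 <= k < n) (T ((j.+1 + k)%:R * d) x - T (k%:R * d) x)).
  apply: eq_bigr => k _; rewrite semigroup_sub ?mulr_ge0 //.
  by rewrite -semigroupD ?mulr_ge0 // -mulrDl -natrD addnC.
rewrite (big_nat_shift (fun k => T (k%:R * d) x)); apply: eq_bigr => k _.
rewrite semigroup_sub ?mulr_ge0 //.
by rewrite -semigroupD ?mulr_ge0 // -mulrDl -natrD addnC.
Qed.

End Averages.

(** * Density of the domain of the generator *)

Lemma dyadic_step_lt (R : realType) (h d : R) : 0 < h -> 0 < d ->
  exists n0, forall n, (n0 <= n)%N -> h / (2 ^ n)%:R < d.
Proof.
move=> h0 d0; exists (Num.truncn (h / d)).+1 => n nn.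
rewrite ltr_pdivrMr ?ltr0n ?expn_gt0 // mulrC -ltr_pdivrMr //.
apply: (lt_le_trans (truncnS_gt _)); rewrite ler_nat.
by rewrite (leq_trans nn) // ltnW // ltn_expl.
Qed.

Section Density.
Variables (R : realType) (X : completeNormedModType (Cx R)).
Variables (T : R -> X -> X) (M : R).
Hypothesis sgT : C0_semigroup T.
Hypothesis M_ge1 : 1 <= M.
Hypothesis T_le : forall (t : R) x, 0 <= t -> rnorm (T t x) <= M * rnorm x.
Implicit Types (x y : X) (t s d e h : R).

Let M_gt0 : 0 < M. Proof. exact: lt_le_trans M_ge1. Qed.

(** By [avg_mul] the difference is a coarse average of [avg T m d x - x], and averaging costs at
    most a factor [M]. *)
Lemma avg_refine n m d x e : 0 < d -> (0 < m)%N ->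
  (forall t, 0 <= t -> t < m%:R * d -> rnorm (T t x - x) <= e) ->
  rnorm (avg T (n * m) d x - avg T n (m%:R * d) x) <= M * e.
Proof.
move=> d0 m0 h; have d0' := ltW d0.
rewrite (avg_mul sgT) // -(avgB sgT) ?mulr_ge0 //.
rewrite (le_trans (rnorm_avg M_ge1 T_le _ _ _)) ?mulr_ge0 // ler_pM2l //.
by apply: avg_near => // k km; rewrite h ?mulr_ge0 // ltr_pM2r // ltr_nat.
Qed.

(** Dyadic grids are nested, so [avg_refine] compares each level directly with a fixed coarse one;
    completeness then supplies the mean over [[0, h]]. *)
Lemma dyadic_avg_cvg h x : 0 < h -> exists y, forall e, 0 < e ->
  exists n0, forall n, (n0 <= n)%N ->
    rnorm (y - avg T (2 ^ n) (h / (2 ^ n)%:R) x) < e.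
Proof.
move=> h0; pose u n := avg T (2 ^ n) (h / (2 ^ n)%:R) x.
have cu : cauchy (u @ \oo).
  apply: cauchy_exP => e e0.
  have er : e = (complex.Re e)%:C by rewrite RRe_real // gtr0_real.
  move: e0; rewrite er ltcR; move: (complex.Re e) => {er}r r0.
  have r2 : 0 < r / 2 / M by rewrite !divr_gt0.
  have [d d0 dP] := semigroup_near0 sgT x r2.
  have [n0 n0P] := dyadic_step_lt h0 d0.
  exists (u n0); exists n0 => // n /= n0n; rewrite -ball_normE /=.
  rewrite normE ltcR rdistC.
  have en : (2 ^ n = 2 ^ n0 * 2 ^ (n - n0))%N by rewrite -expnD subnKC.
  have hn : h / (2 ^ n0)%:R = (2 ^ (n - n0))%:R * (h / (2 ^ n)%:R) :> R.
    rewrite en natrM; field.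
    by rewrite !pnatr_eq0 -!lt0n !expn_gt0.
  rewrite /u hn {1}en; apply: (@le_lt_trans _ _ (M * (r / 2 / M))).
    apply: avg_refine; rewrite ?expn_gt0 ?divr_gt0 ?ltr0n ?expn_gt0 // => t t0.
    by rewrite -hn => tl; rewrite ltW // dP // (lt_trans tl) // n0P.
  by rewrite mulrC divfK ?gt_eqF // ltr_pdivrMr // ltr_pMr // ltr1n.
have : cvg (u @ \oo) by exact: cauchy_cvg.
move=> /cvg_ex[y /rcvgP yP].
exists y => e /yP [n0 _ n0P]; exists n0 => n; exact: n0P.
Qed.

(* Here [y] is the mean of [T t x] over [0, h]; the bound says that the difference
   quotients of [y] tend to [(T h x - x) / h], so that [y] lies in the domain. *)
Lemma mean_increment_le h x y e s : 0 < h -> 0 < s ->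
  (forall e, 0 < e -> exists n0, forall n, (n0 <= n)%N ->
    rnorm (y - avg T (2 ^ n) (h / (2 ^ n)%:R) x) < e) ->
  (forall t, 0 <= t -> t <= s -> rnorm (T t (T h x - x) - (T h x - x)) <= e) ->
  rnorm (T s y - y - (s / h)%:C *: (T h x - x)) <= s / h * e.
Proof.
move=> h0 s0 yP; set l := T h x - x => lP; apply/ler_addgt0Pr => z z0.
(* The denominator adds up the coefficients of [w] in the errors below: [M * w + w] for replacing
   [y] by a Riemann sum, [M * (M * w)] for the leftover time [r], and [w] for the part [r / h] of
   the slope. *)
pose w := z / (M * M + M + 2).
have c0 : 0 < M * M + M + 2 by rewrite !addr_gt0 ?mulr_gt0.
have w0 : 0 < w by rewrite divr_gt0.
have -> : z = M * w + w + M * (M * w) + w by rewrite /w; field; rewrite gt_eqF.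
have [n1 n1P] := yP _ w0.
have [d d0 dP] := semigroup_near0 sgT x w0.
have [n2 n2P] := dyadic_step_lt h0 d0.
have l1 : 0 < rnorm l + 1 by rewrite ltr_wpDl ?rnorm_ge0.
have [n3 n3P] := dyadic_step_lt h0 (divr_gt0 (mulr_gt0 w0 h0) l1).
pose n := maxn n1 (maxn n2 n3).
have {n1P}nP1 := n1P n (leq_maxl _ _).
have {n2P}nP2 : h / (2 ^ n)%:R < d by apply: n2P; rewrite /n !leq_max leqnn orbT.
have {n3P}nP3 : h / (2 ^ n)%:R < w * h / (rnorm l + 1).
  by apply: n3P; rewrite /n !leq_max leqnn !orbT.
have N0 : 0 < (2 ^ n)%:R :> R by rewrite ltr0n expn_gt0.
have hE : (2 ^ n)%:R * (h / (2 ^ n)%:R) = h by rewrite mulrC divfK // gt_eqF.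
move: nP1 nP2 nP3; set q := h / (2 ^ n)%:R in hE *; set yn := avg _ _ _ _.
move=> yny qd ql; have q0 : 0 < q by rewrite divr_gt0.
(* [s] need not be a grid time: [j * q] is the last grid time up to [s], where [avg_shift] applies,
   and [r < q] is left over. *)
pose j := Num.truncn (s / q); pose r := s - j%:R * q.
have /andP[jle jlt] : j%:R <= s / q < j.+1%:R by apply: truncn_itv; rewrite divr_ge0 ?ltW.
have r0 : 0 <= r by rewrite subr_ge0 -ler_pdivlMr.
have rq : r < q by rewrite ltrBlDr -[X in X + _]mul1r -mulrDl -ltr_pdivrMr // nat1r.
have jq0 : 0 <= j%:R * q by rewrite mulr_ge0 // ltW.
have sE : s = j%:R * q + r by rewrite addrC subrK.
have -> : T s y - y - (s / h)%:C *: l = (T s (y - yn) - (y - yn)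
    + T (j%:R * q) (T r yn - yn)) - (r / h)%:C *: l
    + (T (j%:R * q) yn - yn - (j%:R * q / h)%:C *: l).
  have -> : (s / h)%:C = (j%:R * q / h)%:C + (r / h)%:C by rewrite -rmorphD -mulrDl -sE.
  have s0' := ltW s0.
  rewrite !(semigroup_sub sgT) // -(semigroupD sgT) // -sE scalerDl.
  move: (T s y) (T s yn) (T _ yn) (_ *: l) (_ *: l) => a b c u v.
  rewrite !opprB !opprD !addrA; 
  by rewrite [RHS](ACl (1*4*10*7*(2*5)*(6*8)*(3*9))%AC) /= !addNr subrr !addr0.
have Mw0 : 0 <= M * w by rewrite mulr_ge0 // ltW.
rewrite [X in rnorm X]addrC; apply: (le_trans (rnormD _ _)); apply: lerD.
  have -> : j%:R * q / h = j%:R / (2 ^ n)%:R.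
    by rewrite /q; field; rewrite !gt_eqF.
  rewrite (avg_shift sgT) ?(ltW q0) // hE -/l -scalerBr rnormZ.
  rewrite ger0_norm ?divr_ge0 //.
  have -> : j%:R / (2 ^ n)%:R = j%:R * q / h.
    by rewrite /q; field; rewrite !gt_eqF.
  have e0 := le_trans (rnorm_ge0 _) (lP 0 (lexx 0) (ltW s0)).
  have jqs : j%:R * q <= s by rewrite -ler_pdivlMr.
  apply: (@le_trans _ _ (j%:R * q / h * e)); last first.
    by rewrite ler_wpM2r // ler_pM2r // invr_gt0.
  have [->|j0] := posnP j; first by rewrite !mul0r.
  rewrite ler_wpM2l //; first by rewrite divr_ge0 // ltW.
  apply: avg_near => // k kj; apply: lP; first by rewrite mulr_ge0 // ltW.
  by rewrite (le_trans _ jqs) // ler_pM2r // ler_nat ltnW.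
apply: (le_trans (rnormD _ _)); apply: lerD.
  apply: (le_trans (rnormD _ _)); apply: lerD.
    apply: (le_trans (rnormD _ _)); rewrite rnormN; apply: lerD; last exact: ltW.
    by rewrite (le_trans (T_le _ (ltW s0))) // ler_pM2l // ltW.
  rewrite (le_trans (T_le _ _)) // ler_pM2l //.
  rewrite (semigroup_avg sgT) ?(ltW q0) // -(avgB sgT) ?(ltW q0) //.
  rewrite (le_trans (rnorm_avg M_ge1 T_le _ _ (ltW q0))) // ler_pM2l // ltW //.
  by rewrite dP // (lt_trans rq).
rewrite rnormN rnormZ ger0_norm; last by rewrite divr_ge0 // ltW.
rewrite mulrAC ler_pdivrMr //; apply: (@le_trans _ _ (q * (rnorm l + 1))).
  by apply: ler_pM; rewrite ?rnorm_ge0 ?(ltW rq) // lerDl.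
by rewrite -ler_pdivlMr // ltW.
Qed.

(** The witness is the mean of the orbit of [x] over a short [[0, h]], which is close to [x] by
    strong continuity at 0. *)
Lemma generator_domain_dense (D : set X) (A : X -> X) x e :
  generator T D A -> 0 < e -> exists2 y, D y & rnorm (y - x) < e.
Proof.
move=> genT e0; have e20 : 0 < e / 2 by rewrite divr_gt0.
have [d d0 dP] := semigroup_near0 sgT x e20.
pose h := d / 2; have h0 : 0 < h by rewrite divr_gt0.
have hd : h < d by rewrite /h; lra.
have [y yP] := dyadic_avg_cvg x h0; exists y.
  apply/(genT y).1; exists ((h^-1)%:C *: (T h x - x)).
  apply/rcvg_rightP => e1 e10.
  have he : 0 < h * e1 / 2 by rewrite !mulr_gt0 ?invr_gt0.
  have [d1 d10 d1P] := semigroup_near0 sgT (T h x - x) he.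
  exists d1 => // s s0 sd.
  have H : rnorm (T s y - y - (s / h)%:C *: (T h x - x)) <= s / h * (h * e1 / 2).
    apply: mean_increment_le => // t t0 ts.
    by rewrite ltW // d1P // (le_lt_trans ts).
  have -> : (s^-1)%:C *: (T s y - y) - (h^-1)%:C *: (T h x - x) =
      (s^-1)%:C *: (T s y - y - (s / h)%:C *: (T h x - x)).
    rewrite [RHS]scalerBr scalerA -rmorphM /=; congr (_ - _%:C *: _).
    by field; rewrite !gt_eqF.
  rewrite rnormZ ger0_norm ?invr_ge0 ?ltW // ltr_pdivrMl //.
  apply: (le_lt_trans H).
  have -> : s / h * (h * e1 / 2) = s * e1 / 2 by field; rewrite gt_eqF.
  have := mulr_gt0 s0 e10; lra.
have [n nP] := yP _ e20; have {nP} := nP n (leqnn _).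
have N0 : 0 < (2 ^ n)%:R :> R by rewrite ltr0n expn_gt0.
set yn := avg _ _ _ _ => yny.
have ynx : rnorm (yn - x) <= e / 2.
  apply: avg_near => [|k kn]; rewrite ?expn_gt0 // ltW // dP //.
    by rewrite mulr_ge0 // divr_ge0 // ltW.
  apply: le_lt_trans hd; rewrite mulrA ler_pdivrMr // mulrC ler_pM2l //.
  by rewrite ler_nat ltnW.
have -> : y - x = (y - yn) + (yn - x) by rewrite addrA subrK.
apply: (le_lt_trans (rnormD _ _)); lra.
Qed.

End Density.

(** * Invariance of the domain under the semigroup *)

Section Generator.
Variables (R : realType) (X : completeNormedModType (Cx R)).
Variables (T : R -> X -> X) (M : R) (D : set X) (A : X -> X).
Hypothesis sgT : C0_semigroup T.
Hypothesis M_ge1 : 1 <= M.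
Hypothesis T_le : forall (t : R) x, 0 <= t -> rnorm (T t x) <= M * rnorm x.
Hypothesis genT : generator T D A.
Implicit Types (x y z v : X) (t s d e : R).

Let M_gt0 : 0 < M. Proof. exact: lt_le_trans M_ge1. Qed.

Definition diff_quotient (d : R) (x : X) : X := (d^-1)%:C *: (T d x - x).

Lemma generator_near0 x e : D x -> 0 < e ->
  exists2 d, 0 < d & forall t, 0 < t -> t < d -> rnorm (diff_quotient t x - A x) < e.
Proof. by move=> Dx e0; have /rcvg_rightP/(_ _ e0) := (genT x).2 Dx. Qed.

Lemma semigroup_step x d : 0 < d -> T d x = x + d%:C *: diff_quotient d x.
Proof.
move=> d0; rewrite /diff_quotient scalerA -rmorphM mulfV ?gt_eqF // scale1r.
by rewrite addrC subrK.
Qed.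

(** [T t] commutes with the difference quotients and is bounded, so it carries their convergence at
    [x] over to [T t x]. *)
Lemma generator_semigroup t x : D x -> 0 <= t -> D (T t x) /\ A (T t x) = T t (A x).
Proof.
move=> Dx t0.
have cv : (h^-1)%:C *: (T h (T t x) - T t x) @[h --> 0^'+] --> T t (A x).
  apply/rcvg_rightP => e e0.
  have [d d0 dP] := generator_near0 Dx (divr_gt0 e0 M_gt0).
  exists d => // h h0 hd.
  have -> : T h (T t x) = T t (T h x).
    by rewrite -!(semigroupD sgT) ?(ltW h0) // addrC.
  rewrite -(semigroup_sub sgT) // -(semigroup_scale sgT) // -(semigroup_sub sgT) //.
  by rewrite (le_lt_trans (T_le _ t0)) // mulrC -ltr_pdivlMr // dP.
have DT : D (T t x) by apply/(genT _).1; exists (T t (A x)).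
split=> //; exact: (cvg_unique (@norm_hausdorff _ _) ((genT _).2 DT) cv).
Qed.

End Generator.

(** Homogeneity is asked for real scalars only, since the instances are real parts of sesquilinear
    forms. *)
Definition bounded_real_form (R : realType) (X : normedModType (Cx R))
    (q : X -> X -> R) (K : R) :=
  [/\ forall x y z, q (x + y) z = q x z + q y z,
      forall x y z, q z (x + y) = q z x + q z y,
      forall (r : R) x y, q (r%:C *: x) y = r * q x y,
      forall (r : R) x y, q x (r%:C *: y) = r * q x y &
      forall x y, `|q x y| <= K * rnorm x * rnorm y].

Section RealForm.
Variables (R : realType) (X : completeNormedModType (Cx R)).
Variables (q : X -> X -> R) (K : R).
Hypothesis bq : bounded_real_form q K.
Implicit Types x y z v : X.

Lemma real_form_expand z v (r : R) :
  q (z + r%:C *: v) (z + r%:C *: v) =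
  q z z + r * (q z v + q v z) + r ^+ 2 * q v v.
Proof. by case: bq => qDl qDr qZl qZr _; rewrite qDl !qDr !qZl !qZr; ring. Qed.

Lemma real_form_le x y (a b : R) : 0 <= K -> rnorm x <= a -> rnorm y <= b ->
  q x y <= K * a * b.
Proof.
move=> K0 xa yb; case: bq => _ _ _ _ /(_ x y) h.
apply: (le_trans (ler_norm _) (le_trans h _)).
by apply: ler_pM; rewrite ?mulr_ge0 ?rnorm_ge0 // ler_wpM2l.
Qed.

End RealForm.

(** * Lower bounds for forms satisfying the Lyapunov inequality *)

Section LyapunovForm.
Variables (R : realType) (X : completeNormedModType (Cx R)).
Variables (T : R -> X -> X) (M : R) (D : set X) (A : X -> X).
Hypothesis sgT : C0_semigroup T.
Hypothesis M_ge1 : 1 <= M.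
Hypothesis T_le : forall (t : R) x, 0 <= t -> rnorm (T t x) <= M * rnorm x.
Hypothesis genT : generator T D A.
Variables (q : X -> X -> R) (K : R).
Hypothesis K_ge0 : 0 <= K.
Hypothesis bq : bounded_real_form q K.
Hypothesis q_ge0 : forall x, 0 <= q x x.
Hypothesis lyapunov : forall x, D x -> q (A x) x + q x (A x) <= - rnorm x ^+ 2.
Implicit Types (x y z v : X) (t s d e : R).

Let M_gt0 : 0 < M. Proof. exact: lt_le_trans M_ge1. Qed.

(** With [v] the difference quotient of [x], [T (t + d) x] is [T t x + d T t v]. The first-order
    term obeys the Lyapunov inequality up to the error of [v - A x], of size [e]; the second-order
    term carries [d ^+ 2 <= d * e]. The constant depends on [x] but not on [t], so [1 / d] steps
    accumulate an error of order [e] only. *)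
Lemma form_step x t d e : D x -> 0 <= t -> 0 < d -> d <= e -> e <= 1 ->
  rnorm (diff_quotient T d x - A x) <= e ->
  q (T (t + d) x) (T (t + d) x) <= q (T t x) (T t x) - d * rnorm (T t x) ^+ 2
    + d * e * (K * M ^+ 2 * (2 * rnorm x + (rnorm (A x) + 1) ^+ 2)).
Proof.
move=> Dx t0 d0 de e1; set v := diff_quotient T d x => ve.
have [DT AT] := generator_semigroup sgT M_ge1 T_le genT Dx t0.
rewrite (semigroupD sgT) ?(ltW d0) // (semigroup_step T x d0) -/v.
rewrite (semigroup_add sgT) // (semigroup_scale sgT) //.
rewrite (real_form_expand bq).
have Tv : T t v = A (T t x) + T t (v - A x).
  by rewrite AT (semigroup_sub sgT) // addrC subrK.
have [qDl qDr _ _ _] := bq.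
have -> : q (T t x) (T t v) + q (T t v) (T t x) =
    (q (A (T t x)) (T t x) + q (T t x) (A (T t x)))
    + (q (T t x) (T t (v - A x)) + q (T t (v - A x)) (T t x)).
  by rewrite {1 2}Tv qDl qDr; ring.
have h1 := lyapunov DT.
have Tx : rnorm (T t x) <= M * rnorm x by exact: T_le.
have Te : rnorm (T t (v - A x)) <= M * e.
  by rewrite (le_trans (T_le _ t0)) // ler_pM2l.
have h2 := real_form_le bq K_ge0 Tx Te.
have h3 := real_form_le bq K_ge0 Te Tx.
have nv : rnorm v <= rnorm (A x) + 1.
  rewrite -[v](subrK (A x)) (le_trans (rnormD _ _)) // addrC lerD2l.
  exact: le_trans e1.
have Tv' : rnorm (T t v) <= M * (rnorm (A x) + 1).
  by rewrite (le_trans (T_le _ t0)) // ler_pM2l.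
have h4 := real_form_le bq K_ge0 Tv' Tv'.
have h5 : d ^+ 2 * q (T t v) (T t v) <=
    d * e * (K * (M * (rnorm (A x) + 1)) * (M * (rnorm (A x) + 1))).
  apply: (@le_trans _ _ (d ^+ 2 * (K * (M * (rnorm (A x) + 1)) * (M * (rnorm (A x) + 1))))).
    by rewrite ler_wpM2l // sqr_ge0.
  rewrite ler_wpM2r // ?expr2 ?ler_pM2l //.
  by rewrite mulr_ge0 ?mulr_ge0 ?addr_ge0 ?rnorm_ge0 ?(ltW M_gt0).
have h6 : d * (q (A (T t x)) (T t x) + q (T t x) (A (T t x)) +
   (q (T t x) (T t (v - A x)) + q (T t (v - A x)) (T t x))) <=
   d * (- rnorm (T t x) ^+ 2 + (K * (M * rnorm x) * (M * e) + K * (M * e) * (M * rnorm x))).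
  by rewrite ler_pM2l // lerD // lerD.
apply: (le_trans (lerD (lerD (lexx _) h6) h5)).
by rewrite le_eqVlt; apply/predU1P; left; ring.
Qed.

Lemma form_lower_bound x (c : R) : D x -> 0 <= c ->
  (forall t, 0 <= t -> t <= 1 -> c * rnorm x <= rnorm (T t x)) ->
  c ^+ 2 * rnorm x ^+ 2 <= q x x.
Proof.
move=> Dx c0 cT; apply/ler_addgt0Pr => z z0.
pose C := K * M ^+ 2 * (2 * rnorm x + (rnorm (A x) + 1) ^+ 2).
have C0 : 0 <= C.
  by rewrite !mulr_ge0 ?addr_ge0 ?sqr_ge0 ?mulr_ge0 ?rnorm_ge0 ?(ltW M_gt0).
have C1 : 0 < C + 1 by rewrite ltr_wpDl.
pose e := Num.min 1 (z / (C + 1)).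
have e0 : 0 < e by rewrite lt_min ltr01 divr_gt0.
have e1 : e <= 1 by rewrite ge_min lexx.
have eC : e * C <= z.
  apply: (@le_trans _ _ (z / (C + 1) * (C + 1))); last by rewrite divfK ?gt_eqF.
  by apply: ler_pM; rewrite ?(ltW e0) // ?lerDl // ge_min lexx orbT.
have [d0 d0_gt0 d0P] := generator_near0 genT Dx e0.
(* [d] is below [d0] for the difference quotient and below [e] for the second-order term, and [n]
   steps of length [d] end exactly at time 1. *)
pose n := (Num.truncn (Num.min d0 e)^-1).+1; pose d : R := n%:R^-1.
have m0 : 0 < Num.min d0 e by rewrite lt_min d0_gt0.
have d_gt0 : 0 < d by rewrite invr_gt0 ltr0n.
have : d < Num.min d0 e.
  rewrite -[ltRHS]invrK ltf_pV2 ?posrE ?invr_gt0 ?ltr0n //.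
  exact: truncnS_gt.
rewrite lt_min => /andP[dd0 de].
have step k : (k <= n)%N -> q (T (k%:R * d) x) (T (k%:R * d) x) <=
    q x x + k%:R * d * (e * C - c ^+ 2 * rnorm x ^+ 2).
  elim: k => [|k IH] kn; first by rewrite !mul0r addr0 (semigroup0 sgT).
  have kd0 : 0 <= k%:R * d by rewrite mulr_ge0 // ltW.
  have kd1 : k%:R * d <= 1 by rewrite ler_pdivrMr ?ltr0n // mul1r ler_nat ltnW.
  have -> : k.+1%:R * d = k%:R * d + d by rewrite -natr1 mulrDl mul1r.
  have h := form_step Dx kd0 d_gt0 (ltW de) e1 (ltW (d0P _ d_gt0 dd0)).
  have hc : c ^+ 2 * rnorm x ^+ 2 <= rnorm (T (k%:R * d) x) ^+ 2.
    by rewrite -exprMn ler_pXn2r ?nnegrE ?rnorm_ge0 ?mulr_ge0 ?rnorm_ge0 // cT.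
  have {}IH := IH (ltnW kn); apply: (le_trans h); rewrite -/C.
  have := ler_wpM2l (ltW d_gt0) hc; move: IH.
  move: (q _ _) (q _ _) (rnorm (T _ _) ^+ 2) (c ^+ 2 * _) => a b f g; lra.
(* The form is still nonnegative at [T 1 x], so the accumulated decrease cannot exceed [q x x]. *)
have := step n (leqnn n); rewrite mulfV ?pnatr_eq0 // mul1r.
have := q_ge0 (T 1 x); move: (q _ _) (q _ _) (c ^+ 2 * _) => a b f; lra.
Qed.

Lemma form_lower_bound_dense x (c : R) : 0 <= c ->
  (forall y, D y -> c * rnorm y ^+ 2 <= q y y) -> c * rnorm x ^+ 2 <= q x x.
Proof.
move=> c0 cD; apply/ler_addgt0Pr => z z0.
(* [e * C] bounds the cost of moving from [x] to [y]: the cross terms and the quadratic term of [q]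
   (using [e <= 1]), plus [c] times the loss [2 * e * rnorm x] in the squared norm. *)
pose C := K * (2 * rnorm x + 1) + c * (2 * rnorm x).
have N0 := rnorm_ge0 x.
have C0 : 0 <= C by rewrite addr_ge0 ?mulr_ge0 ?addr_ge0 ?mulr_ge0.
have C1 : 0 < C + 1 by rewrite ltr_wpDl.
pose e := Num.min 1 (z / (C + 1)).
have e0 : 0 < e by rewrite lt_min ltr01 divr_gt0.
have e1 : e <= 1 by rewrite ge_min lexx.
have eC : e * C <= z.
  apply: (@le_trans _ _ (z / (C + 1) * (C + 1))); last by rewrite divfK ?gt_eqF.
  by apply: ler_pM; rewrite ?(ltW e0) // ?lerDl // ge_min lexx orbT.
have [y Dy] := generator_domain_dense sgT M_ge1 T_le x genT e0.
set w := y - x => /ltW we.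
have yE : y = x + 1%:C *: w by rewrite scale1r addrC subrK.
have := cD y Dy; rewrite [in q _ _]yE (real_form_expand bq).
rewrite expr1n !mul1r.
have h1 := real_form_le bq K_ge0 (lexx (rnorm x)) we.
have h2 := real_form_le bq K_ge0 we (lexx (rnorm x)).
have h3 := real_form_le bq K_ge0 we we.
have xy : rnorm x - e <= rnorm y.
  rewrite lerBlDr; have -> : x = y - w by rewrite opprB addrC subrK.
  by rewrite (le_trans (rnormD _ _)) // rnormN lerD2l.
have h4 : rnorm x ^+ 2 - 2 * e * rnorm x <= rnorm y ^+ 2.
  have y0 := rnorm_ge0 y; have [xe|ex] := leP (rnorm x) e.
    apply: (@le_trans _ _ 0); last exact: sqr_ge0.
    by rewrite expr2 -mulrBl mulr_le0_ge0 //; lra.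
  have xe0 : 0 <= rnorm x - e by rewrite subr_ge0 ltW.
  have := sqr_ge0 e; have : (rnorm x - e) ^+ 2 <= rnorm y ^+ 2.
    by rewrite ler_pXn2r.
  rewrite sqrrB; move: (rnorm y ^+ 2) (rnorm x ^+ 2) (e ^+ 2) => *; lra.
have := ler_wpM2l c0 h4.
have h5 : K * e * e <= K * e by rewrite -[leRHS]mulr1 ler_wpM2l // mulr_ge0 // ltW.
move: h1 h2 h3 h5 eC; rewrite /C.
move: (q _ _) (q _ _) (q _ _) (q _ _) => a1 a2 a3 a4; lra.
Qed.

End LyapunovForm.

(** * Left-invertibility gives strong positivity *)

Section StrongPositivity.
Variables (R : realType) (X : completeNormedModType (Cx R)).
Variables (T : R -> X -> X) (D : set X) (A : X -> X).
Hypothesis sgT : C0_semigroup T.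
Hypothesis genT : generator T D A.

Lemma stable_rnorm_le : unif_exp_stable T -> exists M e : R,
  [/\ 1 <= M, 0 < e & forall t x, 0 <= t ->
      rnorm (T t x) <= M * expR (- (e * t)) * rnorm x].
Proof.
move=> [M [e [M1 [e0 h]]]]; exists M, e; split=> // t x t0.
by rewrite -lecR rmorphM /= -!normE h.
Qed.

Lemma stable_rnorm_bound (M e : R) : 1 <= M -> 0 < e ->
  (forall t x, 0 <= t -> rnorm (T t x) <= M * expR (- (e * t)) * rnorm x) ->
  forall t x, 0 <= t -> rnorm (T t x) <= M * rnorm x.
Proof.
move=> M1 e0 h t x t0; apply: (le_trans (h t x t0)).
rewrite ler_wpM2r ?rnorm_ge0 // ler_piMr ?(le_trans ler01) //.
by rewrite -expR0 ler_expR oppr_le0 mulr_ge0 // ltW.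
Qed.

Lemma Re_bounded_real_form (Q : X -> X -> Cx R) : bounded_op_to_dual Q ->
  exists2 K : R, 0 <= K & bounded_real_form (fun x y => complex.Re (Q x y)) K.
Proof.
move=> [Ql [Qr [K KP]]]; exists `|K| => //.
have Q0l z : Q 0 z = 0.
  by apply: (addrI (Q 0 z)); rewrite addr0 -{1}(mul1r (Q 0 z)) -Qr scale1r addr0.
have Q0r z : Q z 0 = 0.
  have := (Ql z).1 1 0 0; rewrite scale1r addr0 conjC1 mul1r => h.
  by apply: (addrI (Q z 0)); rewrite addr0 -h.
split=> [x y z|x y z|r x y|r x y|x y] /=.
- by have := Qr 1 x y z; rewrite scale1r mul1r => ->; case: (Q x z) (Q y z) => ? ? [].
- by have := (Ql z).1 1 x y; rewrite scale1r conjC1 mul1r => ->; case: (Q z x) (Q z y) => ? ? [].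
- have := Qr r%:C x 0 y; rewrite addr0 Q0l addr0 => ->.
  by case: (Q x y) => ? ? /=; rewrite mul0r subr0.
- have := (Ql x).1 r%:C y 0; rewrite addr0 Q0r addr0 => ->.
  rewrite conj_Creal ?complex_real //.
  by case: (Q x y) => ? ? /=; rewrite mul0r subr0.
- rewrite -lecR (le_trans (normc_ge_Re _)) // (le_trans (KP x y)) //.
  rewrite !rmorphM /= -!normE ler_wpM2r // ler_wpM2r // lecR; exact: ler_norm.
Qed.

Lemma left_invertible_strongly_positive (Q : X -> X -> Cx R) :
  unif_exp_stable T -> left_invertible T -> in_LA D A Q -> strongly_positive Q.
Proof.
move=> /stable_rnorm_le[M [e [M1 e0 /(stable_rnorm_bound M1 e0) T_le]]].
have M0 : 0 < M by exact: lt_le_trans M1.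
move=> [m [m0 mP]] [bQ [Q0 lyap]].
have [K K0 bq] := Re_bounded_real_form bQ.
(* [m] may have infimum 0 on [[0, 1]]. Time 1 alone suffices: [T 1 x = T (1 - t) (T t x)] gives
   [m 1 * |x| <= M * |T t x|] for all [t] in [[0, 1]]. *)
pose c := m 1 / M; have c0 : 0 < c by rewrite divr_gt0 // m0.
have cT x t : 0 <= t -> t <= 1 -> c * rnorm x <= rnorm (T t x).
  move=> t0 t1; rewrite mulrAC ler_pdivrMr // [leRHS]mulrC.
  have h : m 1 * rnorm x <= rnorm (T 1 x).
    by rewrite -lecR rmorphM /= -!normE mP.
  apply: (le_trans h); rewrite -{1}(subrK t 1) (semigroupD sgT) ?subr_ge0 //.
  by rewrite T_le // subr_ge0.
exists (c ^+ 2); split=> [|x]; first by rewrite exprn_gt0.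
(* The order on [Cx R] requires equal imaginary parts, so positivity of [Q] makes [Q x x] real. *)
have ImQ : complex.Im (Q x x) = 0 by apply/eqP; have := Q0 x; rewrite lecE => /andP[].
rewrite lecE; apply/andP; split.
  by rewrite ImQ normE -rmorphXn -rmorphM.
rewrite normE -rmorphXn -rmorphM /=.
apply: (form_lower_bound_dense sgT M1 T_le genT K0 bq) => [|y Dy]; first exact: sqr_ge0.
apply: (form_lower_bound sgT M1 T_le genT K0 bq) => //; last 2 first.
- exact: ltW.
- by move=> t; exact: cT.
- by move=> z /=; have := Q0 z; rewrite lecE => /andP[].
move=> z Dz /=; have := lyap z Dz; rewrite lecE => /andP[_].
by rewrite normE -rmorphXn; case: (Q _ z) (Q z _) => ? ? [].
Qed.

End StrongPositivity.

(** * Generalized limits of bounded sequences *)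

Lemma bounded_ultra_cvg (R : realType) (U : set_system nat) (u : nat -> R) (K : R) :
  UltraFilter U -> (forall n, `|u n| <= K) -> exists l : R, u @ U --> l.
Proof.
move=> UU uK; have UP : ProperFilter U := @ultra_proper _ _ UU.
have [p [_ pc]] : `[- K, K] `&` cluster (u @ U) !=set0.
  apply: segment_compact; suff : U (u @^-1` `[- K, K]) by [].
  by apply: filterS filterT => n _ /=; rewrite in_itv /= -ler_norml.
(* An ultrafilter converges to its cluster points: otherwise the preimage of the complement of a
   neighbourhood [B] of [p] would belong to [U], although [p] is a cluster point. *)
exists p => B Bp; have [//|UB] := in_ultra_setVsetC (u @^-1` B) UU.
by have [x []] := pc (~` B) B UB Bp.
Qed.

Definition bounded_real_seq (R : realType) (u : nat -> R) :=
  exists K : R, forall n, `|u n| <= K.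

(** [L] is the limit along an ultrafilter finer than [\oo], which exists for every bounded sequence
    and inherits linearity and eventual upper bounds. *)
Lemma exists_generalized_limit (R : realType) : exists L : (nat -> R) -> R,
  (forall (a : R) u v, bounded_real_seq u -> bounded_real_seq v ->
     L (fun n => a * u n + v n) = a * L u + L v) /\
  (forall u (c : R), bounded_real_seq u -> (\forall n \near \oo, u n <= c) ->
     L u <= c).
Proof.
have [U [UU oU]] := ultraFilterLemma (F := \oo) _.
have UP : ProperFilter U := @ultra_proper _ _ UU.
(* The default 0 is taken where no limit exists, whence the boundedness conditions on the
   sequences. *)
pose L u := xget (0 : R) [set l | u @ U --> l].
have LP u : bounded_real_seq u -> u @ U --> L u.
  move=> [K uK]; have [l ul] := bounded_ultra_cvg UU uK.
  by apply: (@xgetPex _ (0 : R) [set l : R | u @ U --> l]); exists l.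
exists L; split=> [a u v ub vb|u c ub uc]; last first.
  exact: (cvgr_to_le (LP _ ub) (oU _ uc)).
have auv : bounded_real_seq (fun n => a * u n + v n).
  case: ub vb => [K uK] [K' vK]; exists (`|a| * K + K') => n.
  by rewrite (le_trans (ler_normD _ _)) // normrM lerD // ler_wpM2l.
apply: (cvg_unique (@norm_hausdorff _ _) (LP _ auv)).
exact: cvgD (cvgM (cvg_cst a) (LP _ ub)) (LP _ vb).
Qed.

(** * From real forms to operators into the antidual *)

Section Complexification.
Variables (R : realType) (X : completeNormedModType (Cx R)).
Variables (q : X -> X -> R) (K : R).
Hypothesis K_ge0 : 0 <= K.
Hypothesis bq : bounded_real_form q K.
Hypothesis qC : forall x y, q x y = q y x.
Local Notation ic := ('i%C : Cx R).
Hypothesis q_i : forall x y, q (ic *: x) (ic *: y) = q x y.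
Implicit Types x y z : X.

(** A form antilinear in its second slot satisfies [Q x (i y) = - i Q x y], whose real part is the
    imaginary part of [Q x y]; hence [Q] is recovered from its real part [q]. *)
Definition complexify x y : Cx R := q x y +i* q x (ic *: y).

Let qDl x y z : q (x + y) z = q x z + q y z. Proof. by case: bq. Qed.
Let qDr x y z : q z (x + y) = q z x + q z y. Proof. by case: bq. Qed.
Let qZl (r : R) x y : q (r%:C *: x) y = r * q x y. Proof. by case: bq. Qed.
Let qZr (r : R) x y : q x (r%:C *: y) = r * q x y. Proof. by case: bq. Qed.

Let qNr x y : q x (- y) = - q x y.
Proof. by rewrite -scaleN1r -(rmorphN1 (real_complex R)) qZr mulN1r. Qed.

Let ii x : ic *: (ic *: x) = - x.
Proof. by rewrite scalerA -expr2 sqr_i scaleN1r. Qed.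

Let q_il x y : q (ic *: x) y = - q x (ic *: y).
Proof. by rewrite -[LHS]q_i ii qC qNr qC. Qed.

Let scaleCE (a : Cx R) x :
  a *: x = (complex.Re a)%:C *: x + (complex.Im a)%:C *: (ic *: x).
Proof. by rewrite scalerA -scalerDl mulrC -complexE. Qed.

Lemma complexify_linl (a : Cx R) x y z :
  complexify (a *: x + y) z = a * complexify x z + complexify y z.
Proof.
rewrite /complexify !qDl scaleCE !qDl !qZl !q_il ii qNr.
by case: a => r s /=; congr Complex; rewrite /=; ring.
Qed.

Lemma complexifyC x y : complexify y x = (complexify x y)^*.
Proof.
rewrite /complexify; congr Complex; first exact: qC.
by rewrite qC q_il.
Qed.

Lemma complexify_linr (a : Cx R) x y z :
  complexify z (a *: x + y) = a^* * complexify z x + complexify z y.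
Proof.
by rewrite [LHS]complexifyC complexify_linl (complexifyC x z) (complexifyC y z)
  rmorphD rmorphM.
Qed.

Lemma rnormi x : rnorm (ic *: x) = rnorm x.
Proof. by rewrite /rnorm normrZ normc_def /= expr0n expr1n add0r sqrtr1 mul1r. Qed.

Lemma normc_le_Re_Im (z : R[i]) : `|z| <= (`|complex.Re z| + `|complex.Im z|)%:C.
Proof.
rewrite {1}(complexE z) (le_trans (ler_normD _ _)) // rmorphD /= normrM lerD //.
  by rewrite normc_def /= expr0n addr0 sqrtr_sqr.
by rewrite !normc_def /= !expr0n expr1n add0r sqrtr1 mul1r addr0 sqrtr_sqr.
Qed.

Lemma norm_complexify x y : `|complexify x y| <= (2 * K)%:C * `|x| * `|y|.
Proof.
apply: (le_trans (normc_le_Re_Im _)); rewrite !normE -!rmorphM lecR /=.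
case: bq => _ _ _ _ qK; have := qK x (ic *: y); rewrite rnormi.
have := qK x y; lra.
Qed.

Lemma complexify_bounded : bounded_op_to_dual complexify.
Proof.
split; last split; last by exists (2 * K); exact: norm_complexify.
  move=> z; split=> [a x y|x]; first exact: complexify_linr.
  have C0 : 0 <= (2 * K)%:C * `|z| :> Cx R by rewrite mulr_ge0 // ler0c mulr_ge0.
  apply/cvgrPdist_lt => e e0; near=> y.
  have -> : complexify z x - complexify z y = complexify z (x - y).
    have := complexify_linr (-1) y x z.
    by rewrite scaleN1r rmorphN1 mulN1r addrC => ->; rewrite addrC.
  apply: (le_lt_trans (norm_complexify _ _)).
  apply: (@le_lt_trans _ _ (((2 * K)%:C * `|z| + 1) * `|x - y|)).
    by rewrite ler_wpM2r // lerDl.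
  rewrite mulrC -ltr_pdivlMr ?ltr_wpDl //.
  near: y; apply: (@cvgr_dist_lt _ _ _ _ _ id x cvg_id).
  by rewrite divr_gt0 // ltr_wpDl.
exact: complexify_linl.
Unshelve. all: by end_near. Qed.

(** Hermitian symmetry makes the Lyapunov expression real and equal to [2 * q x (A x)]. *)
Lemma complexify_in_LA (D : set X) (A : X -> X) :
  (forall x, 0 <= q x x) ->
  (forall x, D x -> 2 * q x (A x) <= - rnorm x ^+ 2) ->
  in_LA D A complexify.
Proof.
move=> q0 lyap; split; first exact: complexify_bounded.
have qix x : q x (ic *: x) = 0.
  by have := q_il x x; rewrite qC; lra.
split=> [x|x Dx]; first by rewrite lecE /= qix eqxx q0.
rewrite normE -rmorphXn lecE /=; apply/andP; split.
  by rewrite oppr0 qC q_il qC addNr.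
by have := lyap x Dx; rewrite (qC (A x)); lra.
Qed.

End Complexification.

(** * Riemann sums for the Gramian and their limit *)

Lemma riemann_indicator_le (R : realType) (d s : R) (n : nat) : 0 < d -> 0 <= s ->
  \sum_(0 <= k < n) d * (k%:R * d < s)%R%:R <= s + d.
Proof.
move=> d0 s0.
(* The second bound drives the induction: a node [n * d] below [s] adds [d] to a sum that is at most
   [n * d]. *)
suff /andP[] : (\sum_(0 <= k < n) d * (k%:R * d < s)%R%:R <= s + d)
            && (\sum_(0 <= k < n) d * (k%:R * d < s)%R%:R <= n%:R * d) by [].
elim: n => [|n /andP[IH1 IH2]]; first by rewrite big_geq // mul0r lexx addr_ge0 // ltW.
rewrite big_nat_recr //=; have [h|h] := ltP (n%:R * d) s.
  by rewrite mulr1 -natr1 mulrDl mul1r !lerD2r IH2 (le_trans IH2) // ltW.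
by rewrite mulr0 addr0 IH1 (le_trans IH2) // ler_pM2r // ler_nat.
Qed.

Section Gramian.
Variables (R : realType) (X : completeNormedModType (Cx R)).
Variables (T : R -> X -> X) (M : R) (D : set X) (A : X -> X).
Hypothesis sgT : C0_semigroup T.
Hypothesis M_ge1 : 1 <= M.
Hypothesis T_le : forall (t : R) x, 0 <= t -> rnorm (T t x) <= M * rnorm x.
Hypothesis genT : generator T D A.
Variables (b : X -> X -> R) (K tau : R).
Hypothesis K_ge0 : 0 <= K.
Hypothesis bb : bounded_real_form b K.
Hypothesis bC : forall x y, b x y = b y x.
Local Notation ic := ('i%C : Cx R).
Hypothesis b_i : forall x y, b (ic *: x) (ic *: y) = b x y.
Hypothesis b_ge0 : forall x, 0 <= b x x.
Hypothesis tau_gt0 : 0 < tau.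
Implicit Types (x y z v : X) (t s e : R) (n : nat).

Let M_gt0 : 0 < M. Proof. exact: lt_le_trans M_ge1. Qed.

Let step n : R := tau / n.+1%:R.

Let step_gt0 n : 0 < step n. Proof. by rewrite divr_gt0. Qed.

Let time_ge0 n k : 0 <= k%:R * step n.
Proof. by rewrite mulr_ge0 // ltW. Qed.

Let stepE n : n.+1%:R * step n = tau.
Proof. by rewrite mulrC divfK // pnatr_eq0. Qed.

Definition gram n x y : R :=
  step n * \sum_(0 <= k < n.+1) b (T (k%:R * step n) x) (T (k%:R * step n) y).

Lemma gram_form n : bounded_real_form (gram n) (tau * K * M ^+ 2).
Proof.
have [bDl bDr bZl bZr bK] := bb; rewrite /gram; split.
- move=> x y z; rewrite -mulrDr -big_split /=; congr (_ * _).
  by apply: eq_bigr => k _; rewrite (semigroup_add sgT).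
- move=> x y z; rewrite -mulrDr -big_split /=; congr (_ * _).
  by apply: eq_bigr => k _; rewrite (semigroup_add sgT).
- move=> r x y; rewrite [RHS]mulrCA; congr (_ * _); rewrite mulr_sumr.
  by apply: eq_bigr => k _; rewrite (semigroup_scale sgT).
- move=> r x y; rewrite [RHS]mulrCA; congr (_ * _); rewrite mulr_sumr.
  by apply: eq_bigr => k _; rewrite (semigroup_scale sgT).
move=> x y; rewrite normrM gtr0_norm //.
apply: (@le_trans _ _ (step n * \sum_(0 <= k < n.+1) (K * M ^+ 2 * rnorm x * rnorm y))).
  rewrite ler_pM2l // (le_trans (ler_norm_sum _ _ _)) //.
  apply: ler_sum => k _; apply: (le_trans (bK _ _)).
  have -> : K * M ^+ 2 * rnorm x * rnorm y = K * (M * rnorm x) * (M * rnorm y) by ring.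
  by apply: ler_pM; rewrite ?mulr_ge0 ?rnorm_ge0 ?T_le ?ler_wpM2l ?T_le.
rewrite sumr_const_nat subn0 -[X in _ * X]mulr_natl mulrA (mulrC (step n)) stepE.
by rewrite !mulrA.
Qed.

Lemma gramC n x y : gram n x y = gram n y x.
Proof. by rewrite /gram; congr (_ * _); apply: eq_bigr => k _; rewrite bC. Qed.

Lemma gram_i n x y : gram n (ic *: x) (ic *: y) = gram n x y.
Proof.
rewrite /gram; congr (_ * _); apply: eq_bigr => k _.
by rewrite !(semigroup_scale sgT) // b_i.
Qed.

Lemma gram_ge0 n x : 0 <= gram n x x.
Proof. by rewrite mulr_ge0 ?(ltW (step_gt0 n)) // sumr_ge0. Qed.

Lemma gram_shift n x : gram n (T (step n) x) (T (step n) x) - gram n x x =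
  step n * (b (T tau x) (T tau x) - b x x).
Proof.
rewrite /gram -mulrBr -sumrB; congr (_ * _).
pose F k := b (T (k%:R * step n) x) (T (k%:R * step n) x).
transitivity (\sum_(0 <= k < n.+1) (F k.+1 - F k)).
  apply: eq_bigr => k _; rewrite /F -(semigroupD sgT) ?(ltW (step_gt0 n)) //.
  by rewrite -natr1 mulrDl mul1r.
by rewrite telescope_sumr // /F stepE mul0r (semigroup0 sgT).
Qed.

Lemma gram_lyapunov n x (v := diff_quotient T (step n) x) :
  2 * gram n x v + step n * gram n v v = b (T tau x) (T tau x) - b x x.
Proof.
apply: (mulfI (lt0r_neq0 (step_gt0 n))); rewrite -gram_shift.
rewrite (semigroup_step T x (step_gt0 n)) (real_form_expand (gram_form n)).
by rewrite (gramC n v x); ring.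
Qed.

(** Nodes before [s] are bounded through [x] and have total weight at most [s + step n]; later nodes
    factor through [T s x]. *)
Lemma gram_le n x s : 0 <= s ->
  gram n x x <= K * M ^+ 2 * (s + step n) * rnorm x ^+ 2
                + tau * K * M ^+ 2 * rnorm (T s x) ^+ 2.
Proof.
move=> s0; set B := K * M ^+ 2 * rnorm x ^+ 2; set B' := K * M ^+ 2 * rnorm (T s x) ^+ 2.
have C0 : 0 <= K * M ^+ 2 by rewrite mulr_ge0 // sqr_ge0.
have B0 : 0 <= B by rewrite mulr_ge0 // sqr_ge0.
have B0' : 0 <= B' by rewrite mulr_ge0 // sqr_ge0.
have term k : b (T (k%:R * step n) x) (T (k%:R * step n) x) <=
    (k%:R * step n < s)%R%:R * B + B'.
  have [h|h] := ltP (k%:R * step n) s.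
    have Tx : rnorm (T (k%:R * step n) x) <= M * rnorm x by exact: T_le.
    rewrite mul1r; apply: (le_trans (real_form_le bb K_ge0 Tx Tx)).
    have -> : K * (M * rnorm x) * (M * rnorm x) = B by rewrite /B; ring.
    by rewrite lerDl.
  rewrite mul0r add0r.
  have Tx : rnorm (T (k%:R * step n) x) <= M * rnorm (T s x).
    by rewrite -[X in T X x](subrK s) (semigroupD sgT) ?subr_ge0 // T_le // subr_ge0.
  apply: (le_trans (real_form_le bb K_ge0 Tx Tx)).
  by rewrite le_eqVlt /B'; apply/predU1P; left; ring.
apply: (@le_trans _ _ (step n * \sum_(0 <= k < n.+1) ((k%:R * step n < s)%R%:R * B + B'))).
  by rewrite ler_pM2l //; apply: ler_sum => k _; exact: term.
rewrite big_split /= -mulr_suml sumr_const_nat subn0 mulrDr mulrA mulr_sumr.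
rewrite -(mulr_natl B') (mulrA (step n) n.+1%:R) (mulrC (step n) n.+1%:R) stepE lerD //.
  have := ler_wpM2r B0 (riemann_indicator_le n.+1 (step_gt0 n) s0).
  by move=> h; apply: (le_trans h); rewrite le_eqVlt /B; apply/predU1P; left; ring.
by rewrite /B' !mulrA.
Qed.

Lemma step_cvg0 e : 0 < e -> \forall n \near \oo, step n < e.
Proof.
move=> e0; have h : 0 < e / tau by rewrite divr_gt0.
have := near_infty_natSinv_lt (PosNum h); apply: filterS => n /=.
by rewrite ltr_pdivlMr // mulrC.
Qed.

(* A generalized limit of the Riemann sums [gram n] plays the role of the
   integral of [b (T t x) (T t y)] over [0, tau]: only its linearity and
   monotonicity matter, so that the convergence of the sums is not needed. *)
Lemma exists_gramian : exists q : X -> X -> R,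
  [/\ bounded_real_form q (tau * K * M ^+ 2),
      (forall x y, q x y = q y x) /\ (forall x y, q (ic *: x) (ic *: y) = q x y),
      forall x, 0 <= q x x,
      forall x, D x -> 2 * q x (A x) <= b (T tau x) (T tau x) - b x x &
      forall x s, 0 <= s -> q x x <=
        K * M ^+ 2 * s * rnorm x ^+ 2 + tau * K * M ^+ 2 * rnorm (T s x) ^+ 2].
Proof.
have [L [L_lin L_le]] := exists_generalized_limit R.
have gb x y : bounded_real_seq (fun n => gram n x y).
  by exists (tau * K * M ^+ 2 * rnorm x * rnorm y) => n; case: (gram_form n).
have b0 : bounded_real_seq (fun=> 0 : R) by exists 0 => n; rewrite normr0.
have L0 : L (fun=> 0) = 0.
  have := L_lin 1 _ _ b0 b0; rewrite mulr0 addr0; lra.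
have LZ (a : R) u : bounded_real_seq u -> L (fun n => a * u n) = a * L u.
  by move=> ub; rewrite -[RHS]addr0 -[X in _ + X]L0 -L_lin //; congr L;
    apply/funext => n; rewrite addr0.
have bN u : bounded_real_seq u -> bounded_real_seq (fun n => -1 * u n).
  by move=> [k uk]; exists k => n; rewrite mulN1r normrN.
have L_ge u (c : R) : bounded_real_seq u -> (forall n, c <= u n) -> c <= L u.
  move=> ub uc; rewrite -lerN2 -mulN1r -LZ //; apply: L_le; first exact: bN.
  by apply: filterE => n; rewrite mulN1r lerN2.
have L_le_all u (c : R) : bounded_real_seq u -> (forall n, u n <= c) -> L u <= c.
  by move=> ub uc; apply: L_le => //; apply: filterE.
pose q x y := L (fun n => gram n x y).
have qD (u v w : nat -> R) : (forall n, u n = v n + w n) -> bounded_real_seq v ->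
    bounded_real_seq w -> L u = L v + L w.
  move=> uE vb wb; rewrite -[L v]mul1r -L_lin //; congr L; apply/funext => n.
  by rewrite mul1r.
have qZ (a : R) (u v : nat -> R) : (forall n, u n = a * v n) -> bounded_real_seq v ->
    L u = a * L v.
  by move=> uE vb; rewrite -LZ //; congr L; apply/funext.
exists q; split.
- split=> [x y z|x y z|r x y|r x y|x y].
  + by apply: qD => // n; case: (gram_form n).
  + by apply: qD => // n; case: (gram_form n).
  + by apply: qZ => // n; case: (gram_form n).
  + by apply: qZ => // n; case: (gram_form n).
  have h n : `|gram n x y| <= tau * K * M ^+ 2 * rnorm x * rnorm y.
    by case: (gram_form n).
  rewrite ler_norml; apply/andP; split.
    by apply: L_ge => // n; have := h n; rewrite ler_norml => /andP[].
  by apply: L_le_all => // n; have := h n; rewrite ler_norml => /andP[].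
- by split=> x y; congr L; apply/funext => n; rewrite ?gram_i // gramC.
- by move=> x; apply: L_ge => // n; exact: gram_ge0.
- move=> x Dx; rewrite -LZ //; apply/ler_addgt0Pr => z z0.
  pose C := tau * K * M ^+ 2 * rnorm x.
  have C0 : 0 <= C.
    by rewrite !mulr_ge0 ?rnorm_ge0 ?(ltW tau_gt0) ?(ltW M_gt0).
  have C1 : 0 < C + 1 by rewrite ltr_wpDl.
  have z2 : 0 < z / 2 / (C + 1) by rewrite !divr_gt0.
  have [d d0 dP] := generator_near0 genT Dx z2.
  apply: L_le.
    by have [k uk] := gb x (A x); exists (2 * k) => n;
      rewrite normrM ger0_norm // ler_pM2l.
  (* For large [n], [v] is close to [A x]: replacing [A x] by [v] in [2 * gram n x (A x)] costs at
     most [z], and [gram_lyapunov] applies to [v]. *)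
  near=> n; pose v := diff_quotient T (step n) x.
  have nd : step n < d by near: n; exact: step_cvg0.
  have /ltW ve := dP _ (step_gt0 n) nd.
  rewrite -(gram_lyapunov n x) -/v in ve *.
  have g0 : 0 <= step n * gram n v v by rewrite mulr_ge0 ?gram_ge0 // ltW.
  have [_ gDr _ _ gK] := gram_form n.
  have vE : gram n x v = gram n x (v - A x) + gram n x (A x).
    by rewrite -gDr subrK.
  have h : - gram n x (v - A x) <= z / 2.
    apply: (le_trans (ler_norm _)); rewrite normrN (le_trans (gK _ _)) //.
    rewrite -/C; apply: (@le_trans _ _ ((C + 1) * (z / 2 / (C + 1)))).
      by apply: ler_pM; rewrite ?rnorm_ge0 // lerDl.
    by rewrite mulrC divfK // gt_eqF.
  move: g0 h; rewrite vE; lra.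
move=> x s s0; apply/ler_addgt0Pr => z z0.
pose C := K * M ^+ 2 * rnorm x ^+ 2.
have C0 : 0 <= C by rewrite mulr_ge0 ?sqr_ge0 // mulr_ge0 ?sqr_ge0.
have C1 : 0 < C + 1 by rewrite ltr_wpDl.
apply: L_le => //; near=> n; apply: (le_trans (gram_le _ _ s0)).
have sC : step n * C <= z.
  apply: (@le_trans _ _ (z / (C + 1) * (C + 1))); last by rewrite divfK ?gt_eqF.
  apply: ler_pM; rewrite ?(ltW (step_gt0 n)) // ?lerDl // ltW //.
  by near: n; apply: step_cvg0; rewrite divr_gt0.
have -> : K * M ^+ 2 * (s + step n) * rnorm x ^+ 2 =
  K * M ^+ 2 * s * rnorm x ^+ 2 + step n * C by rewrite /C; ring.
by rewrite addrAC lerD2l.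
Unshelve. all: by end_near. Qed.

End Gramian.

(** * The real form inherited from the Hilbert space *)

Lemma continuous_linear_rnorm_le (R : realType) (V W : normedModType (Cx R))
    (J : V -> W) :
  (forall (a : Cx R) x y, J (a *: x + y) = a *: J x + J y) -> continuous J ->
  exists2 K : R, 0 < K & forall x, rnorm (J x) <= K * rnorm x.
Proof.
move=> Jl Jc.
have J0 : J 0 = 0.
  by apply: (addrI (J 0)); rewrite addr0 -{1}(scale1r (J 0)) -Jl scale1r addr0.
have JZ a x : J (a *: x) = a *: J x by rewrite -[a *: x]addr0 Jl J0 addr0.
have /rcvgP/(_ 1 ltr01)/nbhs_ballP[e /= e0 eP] := Jc 0.
have er : e = (complex.Re e)%:C by rewrite RRe_real // gtr0_real.
move: e0 eP; rewrite er ltcR; move: (complex.Re e) => {er} {}e e0 eP.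
exists (2 / e) => [|x]; first exact: divr_gt0.
have [x0|x_neq0] := eqVneq (rnorm x) 0.
  by rewrite (rnorm_eq0 x0) J0 !rnorm0 mulr0.
have x0 : 0 < rnorm x by rewrite lt_neqAle eq_sym x_neq0 rnorm_ge0.
pose r := e / 2 / rnorm x; have r0 : 0 < r by rewrite !divr_gt0.
have : rnorm (J (r%:C *: x)) < 1.
  rewrite -rnormN -sub0r -J0; apply: eP.
  rewrite -ball_normE /= sub0r normrN normE ltcR rnormZ gtr0_norm //.
  by rewrite divfK ?gt_eqF // ltr_pdivrMr // ltr_pMr // ltr1n.
rewrite JZ rnormZ gtr0_norm // mulrC -ltr_pdivlMr // => /ltW h.
apply: (le_trans h); rewrite le_eqVlt; apply/predU1P; left.
by rewrite /r; field; rewrite !gt_eqF.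
Qed.

Section HilbertForm.
Variables (R : realType) (H : normedModType (Cx R)) (ip : H -> H -> Cx R).
Hypothesis ipH : inner_product_for ip.
Local Notation ic := ('i%C : Cx R).
Implicit Types x y z : H.

Let p x y : R := complex.Re (ip x y).

Lemma Re_ip_addl x y z : p (x + y) z = p x z + p y z.
Proof.
case: ipH => lin _; have := lin 1 x y z; rewrite scale1r mul1r /p => ->.
by case: (ip x z) (ip y z) => ? ? [].
Qed.

Lemma Re_ipC x y : p x y = p y x.
Proof. by case: ipH => _ [sym _]; rewrite /p sym; case: (ip y x). Qed.

Lemma ip_scalel (a : Cx R) x y : ip (a *: x) y = a * ip x y.
Proof.
case: ipH => lin _; have ip0 : ip 0 y = 0.
  by apply: (addrI (ip 0 y)); rewrite addr0 -{1}(mul1r (ip 0 y)) -lin scale1r addr0.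
by rewrite -[a *: x]addr0 lin ip0 addr0.
Qed.

Lemma Re_ip_scalel (r : R) x y : p (r%:C *: x) y = r * p x y.
Proof. by rewrite /p ip_scalel; case: (ip x y) => ? ? /=; rewrite mul0r subr0. Qed.

Lemma Re_ip_i x y : p (ic *: x) (ic *: y) = p x y.
Proof.
case: ipH => _ [sym _]; rewrite /p ip_scalel sym ip_scalel.
rewrite [in RHS]sym; case: (ip y x) => a b /=; ring.
Qed.

Lemma Re_ip_sqr x : p x x = rnorm x ^+ 2.
Proof. by case: ipH => _ [_ sqr]; rewrite /p sqr normE -rmorphXn. Qed.

Lemma Re_ip_norm_le x y : `|p x y| <= rnorm x * rnorm y.
Proof.
have pCr z u v : p z (u + v) = p z u + p z v.
  by rewrite Re_ipC Re_ip_addl !(Re_ipC z).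
have pZr (r : R) u v : p u (r%:C *: v) = r * p u v.
  by rewrite Re_ipC Re_ip_scalel (Re_ipC u).
have exp (r : R) : 0 <= rnorm x ^+ 2 + 2 * r * p x y + r ^+ 2 * rnorm y ^+ 2.
  have := sqr_ge0 (rnorm (x + r%:C *: y)); rewrite -!Re_ip_sqr.
  rewrite Re_ip_addl !pCr !pZr !Re_ip_scalel (Re_ipC y x).
  by congr (_ <= _); ring.
have [y0|y_neq0] := eqVneq (rnorm y) 0.
  rewrite (rnorm_eq0 y0) rnorm0 mulr0 -(scale0r 0) -(rmorph0 (real_complex R)).
  by rewrite pZr mul0r normr0.
have y0 : 0 < rnorm y ^+ 2 by rewrite exprn_gt0 // lt_neqAle eq_sym y_neq0 rnorm_ge0.
rewrite -(@ler_pXn2r _ 2) ?nnegrE ?mulr_ge0 ?rnorm_ge0 // real_normK ?num_real //.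
rewrite exprMn -ler_pdivrMr // -subr_ge0.
(* Cauchy-Schwarz: this [r] minimizes the squared norm of [x + r y]. *)
have := exp (- p x y / rnorm y ^+ 2); congr (_ <= _).
by field.
Qed.

End HilbertForm.

Lemma isomorphic_to_Hilbert_form (R : realType) (X : completeNormedModType (Cx R)) :
  isomorphic_to_Hilbert X -> exists (b : X -> X -> R) (K a : R),
  [/\ 0 <= K, 0 < a, bounded_real_form b K,
      (forall x y, b x y = b y x) /\
      (forall x y, b (('i%C : Cx R) *: x) (('i%C : Cx R) *: y) = b x y) &
      forall x, a * rnorm x ^+ 2 <= b x x].
Proof.
move=> [H [ip [J [ipH [Jl [Jc [J' [JK [J'K J'c]]]]]]]]].
have J'l (a : Cx R) x y : J' (a *: x + y) = a *: J' x + J' y.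
  by apply: (can_inj JK); rewrite Jl !J'K.
have [K K0 KP] := continuous_linear_rnorm_le Jl Jc.
have [k k0 kP] := continuous_linear_rnorm_le J'l J'c.
have J0 : J 0 = 0.
  by apply: (addrI (J 0)); rewrite addr0 -{1}(scale1r (J 0)) -Jl scale1r addr0.
have JZ a x : J (a *: x) = a *: J x by rewrite -[a *: x]addr0 Jl J0 addr0.
have JD x y : J (x + y) = J x + J y by rewrite -(scale1r x) Jl !scale1r.
(* [K] bounds [J], which gives the upper constant; [|x| = |J' (J x)| <= k |J x|] gives the lower
   constant [k ^-2]. *)
exists (fun x y => complex.Re (ip (J x) (J y))), (K ^+ 2), (k ^-2).
have Dl x y z : complex.Re (ip (J (x + y)) (J z)) =
    complex.Re (ip (J x) (J z)) + complex.Re (ip (J y) (J z)).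
  by rewrite JD (Re_ip_addl ipH).
have Zl (r : R) x y : complex.Re (ip (J (r%:C *: x)) (J y)) =
    r * complex.Re (ip (J x) (J y)).
  by rewrite JZ (Re_ip_scalel ipH).
have sym x y := Re_ipC ipH (J x) (J y).
split; [exact: sqr_ge0|by rewrite invr_gt0 exprn_gt0| | |].
- split=> // [x y z|r x y|x y].
  + by rewrite sym Dl !(sym z).
  + by rewrite sym Zl (sym x).
  apply: (le_trans (Re_ip_norm_le ipH _ _)).
  have -> : K ^+ 2 * rnorm x * rnorm y = (K * rnorm x) * (K * rnorm y) by ring.
  by apply: ler_pM; rewrite ?rnorm_ge0.
- by split=> // x y; rewrite !JZ (Re_ip_i ipH).
move=> x; rewrite (Re_ip_sqr ipH) ler_pdivrMl ?exprn_gt0 // -exprMn.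
rewrite ler_pXn2r ?nnegrE ?mulr_ge0 ?rnorm_ge0 ?(ltW k0) //.
by rewrite -{1}(JK x).
Qed.

(** * Strong positivity gives left-invertibility *)

Section LeftInvertibility.
Variables (R : realType) (X : completeNormedModType (Cx R)).
Variables (T : R -> X -> X) (D : set X) (A : X -> X).
Hypothesis sgT : C0_semigroup T.

Lemma left_invertible_of_time (M s m : R) : 1 <= M ->
  (forall (t : R) x, 0 <= t -> rnorm (T t x) <= M * rnorm x) ->
  0 < s -> 0 < m -> (forall x, m * rnorm x <= rnorm (T s x)) -> left_invertible T.
Proof.
move=> M1 T_le s0 m0 mP; have M0 : 0 < M by exact: lt_le_trans M1.
have iter k x : m ^+ k * rnorm x <= rnorm (T (k%:R * s) x).
  elim: k x => [|k IH] x; first by rewrite mul0r (semigroup0 sgT) expr0 mul1r.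
  rewrite -natr1 mulrDl mul1r (semigroupD sgT) ?(ltW s0) ?mulr_ge0 ?(ltW s0) //.
  apply: le_trans (IH _); rewrite exprSr -mulrA ler_pM2l ?exprn_gt0 //.
(* Iterate up to the first multiple of [s] beyond [t]; the factor [M] pays for the time between [t]
   and that multiple. *)
exists (fun t => m ^+ (Num.truncn (t / s)).+1 / M); split=> [t t0|t x t0].
  by rewrite divr_gt0 // exprn_gt0.
rewrite !normE -rmorphM lecR mulrAC ler_pdivrMr // [leRHS]mulrC.
apply: (le_trans (iter _ _)).
have ts : t <= (Num.truncn (t / s)).+1%:R * s.
  by rewrite -ler_pdivrMr // ltW // truncnS_gt.
rewrite -[X in T X x](subrK t) (semigroupD sgT) ?subr_ge0 //.
by rewrite T_le // subr_ge0.
Qed.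

Lemma strongly_positive_left_invertible :
  isomorphic_to_Hilbert X -> generator T D A -> unif_exp_stable T ->
  (forall Q : X -> X -> Cx R, in_LA D A Q -> strongly_positive Q) ->
  left_invertible T.
Proof.
move=> /isomorphic_to_Hilbert_form[b [K [a [K0 a0 bb [bC b_i] ba]]]] genT.
move=> /stable_rnorm_le[M [w [M1 w0 Tw]]] strong.
have T_le := stable_rnorm_bound M1 w0 Tw.
have M0 : 0 < M by exact: lt_le_trans M1.
have b0 x : 0 <= b x x by rewrite (le_trans _ (ba x)) // mulr_ge0 ?sqr_ge0 // ltW.
(* Chosen so that [expR y >= 1 + y] at [y = 2 * w * tau] already yields
   [K (M expR (- w tau))^2 <= a / 2]. *)
pose tau := K * M ^+ 2 / (a * w) + 1.
have tau0 : 0 < tau.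
  by rewrite ltr_wpDl // divr_ge0 ?mulr_ge0 ?sqr_ge0 ?(ltW a0) ?(ltW w0) ?(ltW M0).
have small : K * (M * expR (- (w * tau))) ^+ 2 <= a / 2.
  have h : 2 * K * M ^+ 2 / a <= expR (w * tau) ^+ 2.
    rewrite -expRM_natl (le_trans _ (expR_ge1Dx _)) //.
    have -> : 1 + 2 * (w * tau) = 2 * K * M ^+ 2 / a + (1 + 2 * w).
      by rewrite /tau; field; rewrite !gt_eqF.
    by rewrite lerDl addr_ge0 ?mulr_ge0 ?(ltW w0).
  rewrite expRN exprMn exprVn mulrA ler_pdivrMr ?exprn_gt0 ?expR_gt0 //.
  have -> : K * M ^+ 2 = a / 2 * (2 * K * M ^+ 2 / a) by field; rewrite gt_eqF.
  by rewrite ler_pM2l // divr_gt0.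
have [q [bq [qC q_i] q0 lyap upper]] :=
  exists_gramian sgT M1 T_le genT K0 bb bC b_i b0 tau0.
(* The decay obtained for [q] is [- (a / 2) |x|^2]; the factor [2 / a] normalizes it to the
   [- |x|^2] required by [in_LA]. *)
pose q' x y := 2 / a * q x y.
have a20 : 0 < 2 / a by rewrite divr_gt0.
set B := tau * K * M ^+ 2 in bq upper.
have B0 : 0 <= B by rewrite !mulr_ge0 ?(ltW tau0) ?(ltW M0).
have bq' : bounded_real_form q' (2 / a * B).
  case: bq => qDl qDr qZl qZr qK; rewrite /q'; split=> *.
  - by rewrite qDl mulrDr.
  - by rewrite qDr mulrDr.
  - by rewrite qZl mulrCA.
  - by rewrite qZr mulrCA.
  by rewrite normrM (gtr0_norm a20) -2!(mulrA (2 / a)) ler_pM2l.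
have B'0 : 0 <= 2 / a * B by rewrite mulr_ge0 // ltW.
have LA : in_LA D A (complexify q').
  apply: (complexify_in_LA B'0 bq') => [x y|x y|x|x Dx].
  - by rewrite /q' qC.
  - by rewrite /q' q_i.
  - by rewrite mulr_ge0 // ltW.
  have Tx := Tw tau x (ltW tau0).
  have h1 := real_form_le bb K0 Tx Tx; have h2 := ba x; have h3 := lyap x Dx.
  have h4 := ler_wpM2r (sqr_ge0 (rnorm x)) small.
  have h5 : 2 * q x (A x) <= - (a / 2 * rnorm x ^+ 2).
    have e1 : K * (M * expR (- (w * tau)) * rnorm x) * (M * expR (- (w * tau)) * rnorm x)
      = K * (M * expR (- (w * tau))) ^+ 2 * rnorm x ^+ 2 by ring.
    move: h1 h2 h3 h4; rewrite e1; move: (b _ _) (b _ _) (q _ _).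
    move: (rnorm x ^+ 2) (K * _) => u v c d f; lra.
  have := ler_wpM2l (ltW a20) h5.
  have -> : 2 / a * - (a / 2 * rnorm x ^+ 2) = - rnorm x ^+ 2.
    by field; rewrite gt_eqF.
  by rewrite /q' mulrCA.
have [th [th0 thP]] := strong _ LA.
have {}thP x : th * a / 2 * rnorm x ^+ 2 <= q x x.
  have := thP x; rewrite normE -rmorphXn -rmorphM lecE => /andP[_ /=].
  rewrite /q' => h; have := ler_wpM2l (ltW (divr_gt0 a0 (ltr0Sn R 1))) h.
  have -> : a / 2 * (2 / a * q x x) = q x x by field; rewrite gt_eqF.
  by apply: le_trans; rewrite le_eqVlt; apply/predU1P; left; ring.
have KM0 : 0 <= K * M ^+ 2 by rewrite mulr_ge0 ?sqr_ge0.
pose t := th * a / 2; have t0 : 0 < t by rewrite !mulr_gt0 // invr_gt0.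
(* [t] is the coercivity constant of [q]. For this [s] the early part of the upper bound uses up at
   most [t / 2], so the other half is controlled by [B * |T s x|^2], which dictates [m]. *)
pose s := t / (2 * (K * M ^+ 2 + 1)).
have s0 : 0 < s by rewrite divr_gt0 ?mulr_gt0 // ltr_wpDl.
have KMs : K * M ^+ 2 * s <= t / 2.
  rewrite /s mulrA ler_pdivrMr; last by rewrite mulr_gt0 // ltr_wpDl.
  have -> : t / 2 * (2 * (K * M ^+ 2 + 1)) = (K * M ^+ 2 + 1) * t by field.
  by rewrite ler_pM2r // lerDl.
pose m := Num.sqrt (t / 2 / (B + 1)).
have B1 : 0 < B + 1 by rewrite ltr_wpDl.
have m20 : 0 < t / 2 / (B + 1) by rewrite divr_gt0 // divr_gt0.
apply: (left_invertible_of_time M1 T_le s0 (_ : 0 < m)) => [|x].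
  by rewrite sqrtr_gt0.
rewrite -(@ler_pXn2r _ 2) ?nnegrE ?mulr_ge0 ?rnorm_ge0 ?sqrtr_ge0 //.
rewrite exprMn sqr_sqrtr ?(ltW m20) // mulrAC ler_pdivrMr //.
have h1 := thP x; have h2 := upper x s (ltW s0).
have h3 := ler_wpM2r (sqr_ge0 (rnorm x)) KMs.
have h4 := sqr_ge0 (rnorm (T s x)).
move: h1 h2 h3 h4; rewrite -/t; move: (q x x) (K * _ * s).
move: (rnorm x ^+ 2) (rnorm _ ^+ 2) => u v c d; lra.
Qed.

End LeftInvertibility.

Theorem theorem4p1 (R : realType) (X : completeNormedModType (Cx R))
  (T : R -> X -> X) (D : set X) (A : X -> X) :
  isomorphic_to_Hilbert X ->
  C0_semigroup T -> generator T D A -> unif_exp_stable T ->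
  (left_invertible T <-> (forall Q : X -> X -> Cx R, in_LA D A Q -> strongly_positive Q)).
Proof.
move=> isoX sgT genT stable; split=> [linv Q QLA|strong].
  exact: (left_invertible_strongly_positive sgT genT stable linv QLA).
exact: (strongly_positive_left_invertible sgT isoX genT stable strong).
Qed.
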